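(* Let $p,q$ be real numbers with $0\leq p\leq 1$ and $p<q$. Then every continuous function $\mathbb{N}_{1/n^p}\rightarrow\mathbb{N}_{1/n^q}$ is constant.
   Context: $\mathbb{N}=\{1,2,3,\dots\}$. For a series $\sum_{n=1}^\infty a_n$ of strictly positive real numbers and $A\subseteq\mathbb{N}$, write $\sum_A a_n=\sum_{n\in A}a_n\in[0,\infty]$. $\mathbb{N}_{a_n}$ denotes the set $\mathbb{N}$ with the topology whose closed sets are exactly $\mathbb{N}$ itself and all $A\subseteq\mathbb{N}$ with $\sum_A a_n<\infty$. Thus $\mathbb{N}_{1/n^p}$ is the space obtained from $a_n=1/n^p$. *)

(* Defs.v *)
From HB Require Import structures.
From mathcomp Require Import all_boot all_order all_algebra.
From mathcomp Require Import all_classical all_reals all_analysis.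

Set Implicit Arguments.
Unset Strict Implicit.
Unset Printing Implicit Defensive.

Import Order.TTheory GRing.Theory Num.Theory.
Local Open Scope classical_set_scope.
Local Open Scope ring_scope.

(* The index set is {1, 2, 3, ...}: 0 is excluded. *)
Definition posnat : Type := {n : nat | (0 < n)%N}.
HB.instance Definition _ := Choice.on posnat.

Record posSeq (R : realType) := PosSeq {
  posSeq_fun :> posnat -> R;
  posSeq_gt0 : forall n, 0 < posSeq_fun n }.

Definition sum_over (R : realType) (a : posSeq R) (A : set posnat) : \bar R :=
  (\esum_(n in A) (a n)%:E)%E.

(* An alias of [posnat], indexed by the sequence so that its topology can
   depend on it. *)
Definition series_space (R : realType) (a : posSeq R) : Type := posnat.
HB.instance Definition _ (R : realType) (a : posSeq R) :=
  Choice.copy (series_space a) posnat.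

Section SeriesTopology.
Variables (R : realType) (a : posSeq R).
Implicit Types A B : set (series_space a).

Definition series_closed A : Prop := A = setT \/ (sum_over a A < +oo)%E.

Definition series_open A : Prop := series_closed (~` A).

Let a_ge0 (n : posnat) : (0 <= (a n)%:E)%E.
Proof. by rewrite lee_fin ltW// posSeq_gt0. Qed.

Let sum_over_sub A B : A `<=` B -> (sum_over a A <= sum_over a B)%E.
Proof.
move=> AB; rewrite /sum_over [leLHS]esum_mkcond [leRHS]esum_mkcond.
apply: le_esum => n _; case: ifPn => [/set_mem/AB/mem_set ->//|_].
by case: ifPn.
Qed.

Let sum_overU A B :
  (sum_over a (A `|` B) <= sum_over a A + sum_over a B)%E.
Proof.
rewrite /sum_over [leLHS]esum_mkcond.
rewrite [X in (_ <= X + _)%E]esum_mkcond [X in (_ <= _ + X)%E]esum_mkcond.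
rewrite -esumD; [|by move=> n _; case: ifPn..].
apply: le_esum => n _; rewrite in_setU.
by case: (n \in A); case: (n \in B) => //=; rewrite ?adde0 ?add0e// leeDl.
Qed.

Let series_openT : series_open setT.
Proof. by right; rewrite setCT /sum_over esum_set0. Qed.

Let series_openI : setI_closed series_open.
Proof.
move=> A B; rewrite /series_open /series_closed setCI.
move=> [->|Aoo] [->|Boo]; rewrite ?setTU ?setUT; [by left..|right].
by apply: le_lt_trans (sum_overU _ _) _; rewrite lte_add_pinfty.
Qed.

Let series_open_bigU (I : Type) (F : I -> set (series_space a)) :
  (forall i, series_open (F i)) -> series_open (\bigcup_i F i).
Proof.
move=> Fo; have [[i Fi]|nF] :=
    pselect (exists i, (sum_over a (~` F i) < +oo)%E).
  right; apply: le_lt_trans Fi; apply: sum_over_sub.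
  by apply: subsetC => x Fx; exists i.
left; apply/seteqP; split => // x _ [i _ Fx].
have [Fi|Fi] := Fo i; last by apply: nF; exists i.
by have : (~` F i) x by rewrite Fi.
Qed.

HB.instance Definition _ := @isOpenTopological.Build (series_space a)
  series_open series_openT series_openI series_open_bigU.

Lemma closed_series_spaceE A :
  closed A <-> A = setT \/ (sum_over a A < +oo)%E.
Proof.
by rewrite -openC /open/= /series_open setCK.
Qed.

End SeriesTopology.

Section PowerSequence.
Variables (R : realType) (p : R).

Let inv_pow (n : posnat) : R := 1 / ((val n)%:R `^ p).

Let inv_pow_gt0 n : 0 < inv_pow n.
Proof. by apply: divr_gt0 => //; apply: powR_gt0; rewrite ltr0n (valP n). Qed.

Definition inv_power : posSeq R := PosSeq inv_pow_gt0.

End PowerSequence.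

(* Main.v *)
(* Suppose f is continuous and not constant. Then preimages under f of sets B
   with sum_B b < oo, where b k = k^-q, have finite a-sum, where a n = n^-p, and
   this finiteness is automatically uniform: some d > 0 is such that b-sum <= d
   forces preimages to have a-sum <= 1, since otherwise a union of bad sets B_j
   of b-sum <= 2^-j contradicts the hypothesis. Hence the points k with
   b k <= d/2 whose fibre has a-sum at least (2/d) b k have b-sum at most d/2:
   adding them one at a time, the b-sum stays <= d, so the a-sum stays <= 1, so
   the b-sum in fact stays <= d/2. Up to the finitely many k with b k > d/2,
   every other fibre has a-sum at most (2/d) b k, so the sum of a^(1/p) over it
   is O(b k ^ (1/p)). With p > 0 without loss of generality, a^(1/p) = 1/n and
   b^(1/p) = k^(-q/p) with q/p > 1: the harmonic series would converge. *)

Require Import Defs.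
From mathcomp Require Import all_boot all_order all_algebra.
From mathcomp Require Import all_classical all_reals all_analysis.

Import Order.TTheory GRing.Theory Num.Theory.
Local Open Scope classical_set_scope.
Local Open Scope ring_scope.

(** * Sums of nonnegative families over arbitrary sets *)

Section Esum.
Context {R : realType} {T : choiceType}.
Implicit Types (A B : set T) (u : T -> \bar R).
Local Open Scope ereal_scope.

Lemma subset_esum A B u : (forall x, 0 <= u x) -> A `<=` B ->
  \esum_(x in A) u x <= \esum_(x in B) u x.
Proof.
move=> u0 AB; rewrite [leLHS]esum_mkcond [leRHS]esum_mkcond.
apply: le_esum => x _; case: ifPn => [/set_mem/AB/mem_set ->//|_].
by case: ifPn.
Qed.

Lemma esum_setU_le A B u : (forall x, 0 <= u x) ->
  \esum_(x in A `|` B) u x <= \esum_(x in A) u x + \esum_(x in B) u x.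
Proof.
move=> u0; rewrite (esumID A)//; apply: leeD; apply: subset_esum => //.
by move=> x [[]].
Qed.

Lemma esumZl_le A u (c : R) : (0 <= c)%R -> (forall x, 0 <= u x) ->
  \esum_(x in A) (c%:E * u x) <= c%:E * \esum_(x in A) u x.
Proof.
move=> c0 u0; apply: ge_ereal_sup => _ [F [finF FA] <-].
rewrite -ge0_mule_fsumr// lee_wpmul2l ?lee_fin//.
by apply: ereal_sup_ubound; exists F.
Qed.

(** Finite subsets are given as sequences so that the bound can be proved by induction on a list. *)
Lemma esum_finite_le A u (M : \bar R) :
  (forall s : seq T, [set` s] `<=` A -> \esum_(x in [set` s]) u x <= M) ->
  (forall x, 0 <= u x) ->
  \esum_(x in A) u x <= M.
Proof.
move=> sM u0; apply: ge_ereal_sup => _ [F [finF FA] <-].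
have [s Fs] : exists s : seq T, F = [set` s] by apply/finite_seqP.
by rewrite -esum_fset// Fs; apply: sM; rewrite -Fs.
Qed.

End Esum.

Lemma esum_fibers {R : realType} {T U : choiceType} (f : T -> U) (B : set U)
    (u : T -> \bar R) : (forall x, 0 <= u x)%E ->
  (\esum_(x in f @^-1` B) u x =
   \esum_(y in B) \esum_(x in f @^-1` [set y]) u x)%E.
Proof.
move=> u0; rewrite esum_esum//; apply: reindex_esum => //; split.
- by move=> [y x] /= [By fx]; rewrite /preimage/= fx.
- move=> [y1 x1] [y2 x2]; rewrite !inE/= => -[_ /= <-] [_ /= <-].
  by move=> ->.
- by move=> x /= Bfx; exists (f x, x).
Qed.

(** * Maps under which sets of finite sum have preimages of finite sum *)

Section Pullback.
Context {R : realType} {T U : choiceType}.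
Variables (a : T -> R) (b : U -> R) (f : T -> U).
Hypothesis a0 : forall x, 0 <= a x.
Hypothesis b0 : forall y, 0 < b y.
Local Notation sum_a A := (\esum_(x in A) (a x)%:E)%E.
Local Notation sum_b B := (\esum_(y in B) (b y)%:E)%E.
Hypothesis ab : forall B, (sum_b B < +oo -> sum_a (f @^-1` B) < +oo)%E.

Let Ea0 x : (0 <= (a x)%:E)%E. Proof. by rewrite lee_fin. Qed.
Let Eb0 y : (0 <= (b y)%:E)%E. Proof. by rewrite lee_fin ltW. Qed.

(** Given bad sets [B j], some finite [G] carries all but less than 1 of the [a]-sum over the
    preimage of their union. The preimage of a late [B j] is disjoint from [G] and adds more than 1,
    a contradiction. *)
Lemma pullback_abs_cont : exists2 d : R, 0 < d &
  forall B, (sum_b B <= d%:E -> sum_a (f @^-1` B) <= 1%:E)%E.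
Proof.
apply: contrapT => nd.
have /choice[B BP] : forall j : nat, exists B : set U,
    (sum_b B <= (1 / (2 ^ j.+1)%:R)%:E)%E /\ (1%:E < sum_a (f @^-1` B))%E.
  move=> j; apply: contrapT => nB; apply: nd.
  exists (1 / (2 ^ j.+1)%:R); first by rewrite divr_gt0// ltr0n expn_gt0.
  by move=> B bB; rewrite leNgt; apply/negP => aB; apply: nB; exists B.
pose V := \bigcup_j B j.
have bV : (sum_b V < +oo)%E.
  (* Cutting the [B j] into disjoint pieces turns the sum over [V] into a series, dominated by the
     sum of 2^-(j+1), which is at most 1. *)
  rewrite /V seqDU_bigcup_eq (nneseries_sum_bigcup (trivIset_seqDU B))//.
  apply: (@le_lt_trans _ _ (1%:E)%E); last exact: ltry.
  apply: le_trans (@epsilon_trick0 R 1 xpredT ler01).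
  apply: lee_nneseries => [j _ _|j _]; first exact: esum_ge0.
  apply: le_trans (proj1 (BP j)).
  by apply: subset_esum => //; exact: subset_seqDU.
have aVoo := ab V bV.
have aV : sum_a (f @^-1` V) \is a fin_num.
  by rewrite ge0_fin_numE//; exact: esum_ge0.
have [_ [G [finG GV] <-] Glt] := @ub_ereal_sup_adherent R _ 1 ltr01 aV.
have [s Gs] : exists s : seq T, G = [set` s] by apply/finite_seqP.
(* For this [j], each [f x] with [x] in [G] alone outweighs the bound on the [b]-sum of [B j], so it
   cannot lie in [B j]. *)
have [j jP] : exists j : nat, forall x, x \in s -> 1 / (2 ^ j.+1)%:R < b (f x).
  elim: (s) => [|x s' [j jP]]; first by exists 0%N.
  have [i iP] : exists i : nat, (b (f x))^-1 < i%:R.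
    exists (Num.bound (b (f x))^-1).
    by apply: archi_boundP; rewrite invr_ge0 ltW.
  have anti m n : (m <= n)%N -> 1 / (2 ^ n.+1)%:R <= 1 / (2 ^ m.+1)%:R :> R.
    move=> mn; rewrite ler_pM2l// lef_pV2 ?posrE ?ltr0n ?expn_gt0//.
    by rewrite ler_nat leq_exp2l.
  exists (maxn i j) => y; rewrite inE => /orP[/eqP ->|/jP yP].
    apply: le_lt_trans (anti i _ _) _; first exact: leq_maxl.
    rewrite div1r invf_plt ?posrE ?ltr0n ?expn_gt0//.
    apply: lt_le_trans iP _; rewrite ler_nat.
    by apply: ltnW; apply: ltnW; exact: ltn_expl.
  by apply: le_lt_trans (anti j _ _) yP; exact: leq_maxr.
have [bj aj] := BP j.
have disj x : x \in s -> ~ B j (f x).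
  move=> /jP + Bx; apply/negP; rewrite -leNgt -lee_fin; apply: le_trans bj.
  rewrite -[leLHS](@esum_set1 R U (f x) (fun y => (b y)%:E))//.
  by apply: subset_esum => // _ ->.
have : (sum_a G + sum_a (f @^-1` (B j)) <= sum_a (f @^-1` V))%E.
  rewrite [leRHS](esumID G)//; apply: leeD; apply: subset_esum => //.
    by move=> x Gx; split => //; exact: GV.
  move=> x Bx; split; first by exists j.
  by rewrite Gs => /disj.
have Goo : sum_a G \is a fin_num.
  rewrite ge0_fin_numE; last exact: esum_ge0.
  by apply: le_lt_trans aVoo; exact: subset_esum.
apply/negP; rewrite -ltNge.
move: Glt; rewrite -esum_fset// lteBlDr// => /lt_trans; apply.
by rewrite lteD2lE.
Qed.


Lemma pullback_heavy (d : R) (E : set U) : 0 < d ->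
  (forall B, sum_b B <= d%:E -> sum_a (f @^-1` B) <= 1%:E)%E ->
  (forall y, E y -> b y <= d / 2) ->
  (forall y, E y ->
    (b y)%:E <= (d / 2)%:E * sum_a (f @^-1` [set y]))%E ->
  (sum_b E <= (d / 2)%:E)%E.
Proof.
move=> d0 dP Esmall Eheavy.
have d20 : 0 <= d / 2 by rewrite divr_ge0// ltW.
apply: esum_finite_le => // s; elim: s => [_|y s IH sE].
  by rewrite set_nil esum_set0 lee_fin.
have yE : E y by apply: sE; rewrite /= inE eqxx.
have {}IH : (sum_b [set` s] <= (d / 2)%:E)%E.
  by apply: IH => x /= xs; apply: sE; rewrite /= inE xs orbT.
have /dP a1 : (sum_b [set` y :: s] <= d%:E)%E.
  rewrite (_ : [set` y :: s] = [set y] `|` [set` s]); last first.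
    apply/seteqP; split => x /=; rewrite inE; first by move=> /predU1P.
    by move=> /predU1P.
  apply: le_trans (esum_setU_le _ _ _ _) _ => //.
  rewrite esum_set1// [d in leRHS]splitr EFinD; apply: leeD => //.
  by rewrite lee_fin Esmall.
(* Adding [y] may have used the whole budget [d]; heaviness, summed over the fibres, brings the
   [b]-sum back to d/2. *)
apply: (@le_trans _ _ ((d / 2)%:E * 1%:E)%E); last by rewrite mule1.
apply: le_trans (lee_wpmul2l _ a1); last by rewrite lee_fin.
rewrite esum_fibers//; apply: le_trans (esumZl_le _ _ _ _ _) => //.
- by apply: le_esum => z /sE; exact: Eheavy.
- by move=> z; exact: esum_ge0.
Qed.

(* On a light fibre the terms of [a] are at most a multiple of [b y], so the sum
   of their [r]-th powers is at most a multiple of [b y `^ r]. *)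
Lemma pullback_powR_summable (r : R) : 1 <= r -> (forall x, a x <= 1) ->
  (\esum_(y in setT) (b y `^ r)%:E < +oo)%E ->
  (\esum_(x in setT) (a x `^ r)%:E < +oo)%E.
Proof.
move=> r1 a1 br.
have r0 : 0 <= r by exact: le_trans r1.
have [d d0 dP] := pullback_abs_cont.
have [c c0 cE] : exists2 c : R, 0 < c & d / 2 = c.
  by exists (d / 2) => //; rewrite divr_gt0.
have cge0 := ltW c0.
have pow0 V (u : V -> R) x : (0 <= (u x `^ r)%:E)%E by rewrite lee_fin powR_ge0.
pose L := [set y | b y > c].
pose E := [set y | b y <= c /\
  ((b y)%:E <= c%:E * sum_a (f @^-1` [set y]))%E].
have bE : (sum_b E <= c%:E)%E.
  by rewrite -cE; apply: pullback_heavy d0 dP _ _ => y; rewrite cE => -[].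
(* On [L] the ratio [b y / c] exceeds 1, hence is at most its [r]-th power, so summability of the
   powers suffices. *)
have bL : (sum_b L < +oo)%E.
  apply: (@le_lt_trans _ _
      (\esum_(y in L) ((c / c `^ r)%:E * (b y `^ r)%:E))%E).
    apply: le_esum => y /= cb; rewrite -EFinM lee_fin.
    have bc : 1 <= b y / c by rewrite ler_pdivlMr// mul1r ltW.
    have := le1r_powR bc r1; rewrite ler_pdivrMr// => /le_trans; apply.
    rewrite powRM ?invr_ge0 ?(ltW (b0 y))// -(powR_inv1 cge0) powRAC.
    rewrite powR_inv1 ?powR_ge0//.
    by rewrite mulrC mulrA [leRHS]mulrAC.
  apply: le_lt_trans (esumZl_le _ _ _ _ _) _ => //.
    by rewrite divr_ge0 ?powR_ge0.
  apply: lte_mul_pinfty => //.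
    by rewrite lee_fin divr_ge0 ?powR_ge0.
  by apply: le_lt_trans br; exact: subset_esum.
(* Over [L] and [E], [ab] bounds the sum of [a], which dominates that of its [r]-th powers because
   [a x <= 1 <= r]. The remaining fibres are light. *)
rewrite (esumID (f @^-1` (L `|` E)))// !setTI; apply: lte_add_pinfty.
  apply: (@le_lt_trans _ _ (sum_a (f @^-1` (L `|` E)))).
    apply: le_esum => x _; rewrite lee_fin.
    have [->|ax] := eqVneq (a x) 0.
      by rewrite powR0// gt_eqF// (lt_le_trans _ r1).
    by apply: ge1r_powR => //; rewrite lt_neqAle eq_sym ax a0 a1.
  apply: ab; apply: le_lt_trans (esum_setU_le _ _ _ _) _ => //.
  by apply: lte_add_pinfty => //; apply: le_lt_trans bE _; exact: ltry.
apply: (@le_lt_trans _ _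
    (\esum_(y in ~` (L `|` E)) ((c `^ r)^-1%:E * (b y `^ r)%:E))%E).
  rewrite preimage_setC esum_fibers//; apply: le_esum => y nLE.
  have cb : (c%:E * sum_a (f @^-1` [set y]) <= (b y)%:E)%E.
    rewrite leNgt; apply/negP => /ltW cb; apply: nLE.
    by have [by_le|by_gt] := leP (b y) c; [right|left].
  pose t := c `^ r.
  have t0 : 0 < t by rewrite powR_gt0.
  have xle x : f x = y -> c * a x <= b y.
    move=> fx; rewrite -lee_fin; apply: le_trans cb; rewrite EFinM.
    apply: lee_wpmul2l; first by rewrite lee_fin ltW.
    rewrite -[leLHS](@esum_set1 R T x (fun z => (a z)%:E))//.
    by apply: subset_esum => // _ ->.
  (* Writing (c a)^r = (c a)^(r-1) c a and bounding only the first factor by b^(r-1) gives a^r <= K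
     a; the remaining c a sums over the fibre to at most [b y]. *)
  pose K := t^-1 * b y `^ (r - 1) * c.
  have K0 : 0 <= K.
    by rewrite /K mulr_ge0// mulr_ge0 ?invr_ge0 ?(ltW t0) ?powR_ge0.
  apply: (@le_trans _ _ (\esum_(x in f @^-1` [set y]) (K%:E * (a x)%:E))%E).
    apply: le_esum => x /= fx; rewrite -EFinM lee_fin /K.
    have -> : a x `^ r = t^-1 * (c * a x) `^ r.
      by rewrite powRM// mulrA mulVf ?gt_eqF// mul1r.
    rewrite -!mulrA ler_pM2l ?invr_gt0// -mulr_powRB1; last 2 first.
      by rewrite mulr_ge0.
      by rewrite (lt_le_trans _ r1).
    rewrite mulrC ler_wpM2r// ?mulr_ge0//.
    have := ltW (b0 y); move: (xle x fx) => cab by0.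
    by rewrite ge0_ler_powR ?subr_ge0 ?nnegrE ?mulr_ge0.
  apply: le_trans (esumZl_le _ _ _ _ _) _ => //.
  rewrite /K EFinM -muleA.
  apply: le_trans (lee_wpmul2l _ cb) _.
    by rewrite lee_fin mulr_ge0 ?invr_ge0 ?(ltW t0) ?powR_ge0.
  rewrite -!EFinM lee_fin -mulrA mulrC -/t [X in X * _]mulrC.
  by rewrite mulr_powRB1 ?(ltW (b0 y))// ?(lt_le_trans _ r1)// mulrC.
apply: le_lt_trans (esumZl_le _ _ _ _ _) _ => //.
  by rewrite invr_ge0 powR_ge0.
apply: lte_mul_pinfty => //; first by rewrite lee_fin invr_ge0 powR_ge0.
by apply: le_lt_trans br; exact: subset_esum.
Qed.

End Pullback.

(** * Series of powers of the positive integers *)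

Lemma esum_posnat {R : realType} (u : nat -> \bar R) : (forall n, 0 <= u n)%E ->
  (\esum_(n in [set: posnat]) u (val n) = \sum_(k <oo) u k.+1)%E.
Proof.
move=> u0; rewrite nneseries_esumT//.
pose e (k : nat) : posnat := Sub k.+1 (ltn0Sn k).
rewrite (@reindex_esum R nat posnat setT setT e)//; split => //.
- by move=> i j _ _ /(congr1 val)[].
- by move=> [[//|n] n0] _; exists n => //; exact: val_inj.
Qed.

(** Dividing by x^(-s) leaves 1 + s/x <= (1 - 1/x)^(-s), which follows from 1 + u <= exp u and ln (1
    + v) <= v at v = -1/x. *)
Lemma riemannR_le_telescope {R : realType} (s x : R) : 0 < s -> 1 < x ->
  s * x `^ (- (1 + s)) <= (x - 1) `^ (- s) - x `^ (- s).
Proof.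
move=> s0 x1.
have x0 : 0 < x by exact: lt_trans x1.
have y0 : 0 < 1 - x^-1 by rewrite subr_gt0 invf_lt1.
have -> : x - 1 = x * (1 - x^-1) by rewrite mulrBr mulr1 mulfV// gt_eqF.
have [xge0 yge0] := (ltW x0, ltW y0).
rewrite powRM// opprD powRD; last by rewrite [x == 0]gt_eqF ?implybT.
rewrite powR_inv1//.
rewrite -[X in _ <= _ - X]mulr1 -mulrBr [x^-1 * _]mulrC mulrCA.
rewrite ler_pM2l ?powR_gt0// lerBrDr addrC.
rewrite /powR gt_eqF//.
apply: le_trans (expR_ge1Dx (s * x^-1)) _.
rewrite ler_expR mulNr -mulrN ler_pM2l// lerNr.
by apply: le_ln1Dx; rewrite -subr_gt0 opprK addrC.
Qed.

Lemma posnat_powR_summable {R : realType} (s : R) : 1 < s ->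
  (\esum_(n in [set: posnat]) ((val n)%:R `^ (- s))%:E < +oo)%E.
Proof.
move=> s1; pose t := s - 1.
have t0 : 0 < t by rewrite subr_gt0.
have st : s = 1 + t by rewrite addrC subrK.
rewrite (@esum_posnat R (fun k => (k%:R `^ (- s))%:E)); last first.
  by move=> n; rewrite lee_fin powR_ge0.
apply: (@le_lt_trans _ _ (1 + t^-1)%:E); last exact: ltry.
apply: lime_le.
  by apply: is_cvg_nneseries => n _ _; rewrite lee_fin powR_ge0.
apply: nearW => n.
apply: (@le_trans _ _ (\sum_(0 <= k < n.+1) (k.+1%:R `^ (- s))%:E)%E).
  by rewrite big_nat_recr//= leeDl// lee_fin powR_ge0.
rewrite sumEFin lee_fin.
(* The subtracted term makes the bound telescope; it is an equality for [n = 0], where the sum is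
   the single term 1. *)
apply: (@le_trans _ _ (1 + (t^-1 - t^-1 * n.+1%:R `^ (- t)))); last first.
  by rewrite lerD2l lerBlDr lerDl mulr_ge0 ?powR_ge0// invr_ge0 ltW.
elim: n => [|n IH]; first by rewrite big_nat1 powR1 mulr1 subrr addr0.
rewrite big_nat_recr//=; apply: le_trans (lerD IH (lexx _)) _.
rewrite -addrA lerD2l -addrA lerD2l -lerBrDl opprK addrC -mulrBr.
rewrite ler_pdivlMl// st.
have := @riemannR_le_telescope R t n.+2%:R t0.
rewrite -[X in X - 1](@natr1 R n.+1) addrK; apply.
by rewrite ltr1n.
Qed.

Lemma posnat_harmonic_diverges {R : realType} :
  (\esum_(n in [set: posnat]) ((val n)%:R^-1 : R)%:E = +oo)%E.
Proof.
rewrite (@esum_posnat R (fun k => (k%:R^-1)%:E)); last first.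
  by move=> n; rewrite lee_fin invr_ge0.
apply: contrapT => /eqP; rewrite -ltey => h.
apply: (@dvg_harmonic R).
have h0 k : (0 <= (k.+1%:R^-1 : R)%:E)%E by rewrite lee_fin invr_ge0.
have := @summable_cvg R xpredT (fun k => (k.+1%:R^-1)%:E) (fun i _ => h0 i).
apply; rewrite /summable.
under eq_esum do rewrite gee0_abs//.
by rewrite -nneseries_esum.
Qed.

(** * From continuity to sums over preimages, and the conclusion *)

(** A closed preimage could still be the whole space. Splitting [B] at [f one] excludes this: the
    fibre over [f one] is proper as [f] is not constant, and the preimage of the rest misses
    [one]. *)
Lemma continuous_preimage_summable {R : realType} (a b : posSeq R)
    (f : series_space a -> series_space b) :
  continuous f -> ~ (exists c, forall n, f n = c) ->
  forall B, (sum_over b B < +oo)%E -> (sum_over a (f @^-1` B) < +oo)%E.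
Proof.
move=> /continuous_closedP fc nf B Bb.
have b0 n : (0 <= (b n)%:E)%E by rewrite lee_fin ltW// posSeq_gt0.
have a0 n : (0 <= (a n)%:E)%E by rewrite lee_fin ltW// posSeq_gt0.
have pre A : (sum_over b A < +oo)%E ->
    f @^-1` A = setT \/ (sum_over a (f @^-1` A) < +oo)%E.
  move=> Ab; have /closed_series_spaceE// : closed (f @^-1` A).
  by apply: fc; apply/closed_series_spaceE; right.
pose one : series_space a := Sub 1%N (ltn0Sn 0).
have [fib|fib] : f @^-1` [set f one] = setT \/
    (sum_over a (f @^-1` [set f one]) < +oo)%E.
- by apply: pre; rewrite /sum_over esum_set1// ltry.
- exfalso; apply: nf; exists (f one) => n.
  by have : (f @^-1` [set f one]) n by rewrite fib.
have [dif|dif] : f @^-1` (B `\ f one) = setT \/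
    (sum_over a (f @^-1` (B `\ f one)) < +oo)%E.
- apply: pre; apply: le_lt_trans Bb.
  by apply: subset_esum => [n|x []]; first exact: b0.
- by have [_ /(_ erefl)] : (f @^-1` (B `\ f one)) one by rewrite dif.
have fib_dif := lte_add_pinfty fib dif.
apply: le_lt_trans fib_dif; apply: le_trans (esum_setU_le _ _ _ _) => //.
apply: subset_esum => // x Bx.
by have [fx|fx] := pselect (f x = f one); [left|right].
Qed.

Theorem theorem1p5 (R : realType) (p q : R)
  (hp0 : 0 <= p) (hp1 : p <= 1) (hpq : p < q)
  (f : series_space (inv_power p) -> series_space (inv_power q)) :
  continuous f -> exists c : series_space (inv_power q), forall n, f n = c.
Proof.
move=> fc; apply: contrapT => nf.
have q0 : 0 < q by exact: le_lt_trans hpq.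
(* Raising the source exponent from [p] to [s] only weakens the hypothesis, and
   makes it positive when [p = 0]. *)
have [s [s0 s1 ps sq]] : exists s : R, [/\ 0 < s, s <= 1, p <= s & s < q].
  exists (Num.max p (Num.min (q / 2) 1)); split.
  - by rewrite lt_max lt_min ltr01 divr_gt0 ?orbT.
  - by rewrite ge_max hp1 ge_min lexx orbT.
  - by rewrite le_max lexx.
  - by rewrite gt_max hpq gt_min ltr_pdivrMr// mulr_natr mulr2n ltrDl q0.
have n1 (n : posnat) : 1 <= (val n)%:R :> R by rewrite ler1n (valP n).
have n0 (n : posnat) : 0 < (val n)%:R :> R by rewrite ltr0n (valP n).
have invE (t : R) (n : posnat) : inv_power t n = (val n)%:R `^ (- t).
  by rewrite /= div1r powRN.
pose a (n : posnat) : R := (val n)%:R `^ (- s).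
pose b (n : posnat) : R := (val n)%:R `^ (- q).
have a0 n : 0 <= a n by exact: powR_ge0.
have b0 n : 0 < b n by exact: powR_gt0.
have ab B : (\esum_(n in B) (b n)%:E < +oo)%E ->
    (\esum_(n in f @^-1` B) (a n)%:E < +oo)%E.
  move=> Bb; have : (sum_over (inv_power p) (f @^-1` B) < +oo)%E.
    apply: continuous_preimage_summable => //.
    by rewrite /sum_over; under eq_esum do rewrite invE.
  apply: le_lt_trans; apply: le_esum => n _.
  by rewrite invE lee_fin ler_powR// lerN2.
(* The exponent 1/s turns [a] into the harmonic sequence and [b] into n^(-q/s), summable because q/s
   > 1. *)
have r1 : 1 <= s^-1 by rewrite invf_ge1.
have := pullback_powR_summable a b f a0 b0 ab s^-1 r1.
have -> : (fun n => (a n `^ s^-1)%:E) = (fun n : posnat => ((val n)%:R^-1)%:E).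
  apply/funext => n; rewrite /a -powRrM mulNr mulfV ?gt_eqF//.
  by rewrite powR_inv1// ltW.
rewrite posnat_harmonic_diverges ltxx.
move=> H; apply: notF; apply: H => [n|].
  by rewrite -(powRr0 (val n)%:R) ler_powR// oppr_le0 ltW.
rewrite (_ : (fun n => _) = fun n : posnat => ((val n)%:R `^ (- (q / s)))%:E).
  by apply: posnat_powR_summable; rewrite ltr_pdivlMr// mul1r.
by apply/funext => n; rewrite /b -powRrM mulNr.
Qed.
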